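(* Let $1\le p<n$ be integers. For $P\in \mathrm{Gr}(n,p)$ and $X\in T_P\mathrm{Gr}(n,p)$, choose $Q\in O(n)$ with $P=QP_0Q^T$, let $\Delta\in\mathbb{R}^{(n-p)\times p}$ be the matrix with $X=Q\begin{pmatrix}0&\Delta^T\\ \Delta&0\end{pmatrix}Q^T$, and set $$R_P(X):=\varphi^Q(\Delta)=Q\,\varphi(\Delta)\,Q^T .$$ Then the collection of parameterizations $\{\varphi^Q\mid Q\in O(n)\}$ gives rise in this way to a retraction on $\mathrm{Gr}(n,p)$, i.e. the map $R:T\mathrm{Gr}(n,p)\to\mathrm{Gr}(n,p)$, $(P,X)\mapsto R_P(X)$, is a (well-defined) retraction.
   Context: $\mathrm{Gr}(n,p)=\{P\in\mathbb{R}^{n\times n}\mid P^2=P,\ P^T=P,\ \operatorname{rank}P=p\}$ is the Grassmann manifold of rank-$p$ orthogonal projectors, an embedded submanifold of the space $\mathrm{sym}(n)$ of real symmetric $n\times n$ matrices. $O(n)$ is the orthogonal group and $P_0=\begin{pmatrix}I_p&0\\ 0&0\end{pmatrix}$. Every $P\in\mathrm{Gr}(n,p)$ is of the form $P=QP_0Q^T$ with $Q\in O(n)$, and the tangent space is $$T_P\mathrm{Gr}(n,p)=\left\{Q\begin{pmatrix}0&\Delta^T\\ \Delta&0\end{pmatrix}Q^T\ \middle|\ \Delta\in\mathbb{R}^{(n-p)\times p}\right\}.$$ The base parameterization is $$\varphi:\mathbb{R}^{(n-p)\times p}\to\mathrm{Gr}(n,p),\qquad \varphi(B)=\begin{pmatrix}I_p\\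 B\end{pmatrix}(I_p+B^TB)^{-1}\begin{pmatrix}I_p&B^T\end{pmatrix},$$ and for $Q\in O(n)$, $\varphi^Q:\mathbb{R}^{(n-p)\times p}\to\mathrm{Gr}(n,p)$, $\varphi^Q(B)=Q\varphi(B)Q^T$. A retraction on a manifold $\mathcal{M}$ is a smooth map $R:T\mathcal{M}\to\mathcal{M}$ from the tangent bundle such that, writing $R_p$ for the restriction of $R$ to $T_p\mathcal{M}$, for all $p\in\mathcal{M}$: $R_p(0)=p$ and the differential satisfies $d(R_p)_0=\mathrm{id}_{T_p\mathcal{M}}$ (identifying $T_0(T_p\mathcal{M})$ with $T_p\mathcal{M}$). *)

(* Defs.v *)
From HB Require Import structures.
From mathcomp Require Import all_boot all_order all_algebra.
From mathcomp Require Import all_classical all_reals all_analysis.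

Set Implicit Arguments.
Unset Strict Implicit.
Unset Printing Implicit Defensive.

Import Order.TTheory GRing.Theory Num.Theory.
Import numFieldNormedType.Exports.

Local Open Scope classical_set_scope.
Local Open Scope ring_scope.

Section Smooth.
Context {R : realType}.

(* C^k on an open set U, by iterated directional derivatives; for
   finite-dimensional V, the only case used here, this is the usual notion. *)
Fixpoint Ck_on (V W : normedModType R) (k : nat) (U : set V) (f : V -> W) :
    Prop :=
  if k is k'.+1 then
    (forall x, U x -> differentiable f x) /\
    (forall v, Ck_on k' U (fun x => 'D_v f x))
  else forall x, U x -> {for x, continuous f}.

Definition smooth_on (V W : normedModType R) (U : set V) (f : V -> W) : Prop :=
  forall k, Ck_on k U f.

(* Smoothness on an arbitrary subset A of V is the existence of local smooth
   extensions to open subsets of V. When A is an embedded submanifold, this is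
   smoothness with respect to the manifold structure of A. *)
Definition smooth_within (V W : normedModType R) (A : set V) (f : V -> W) :
    Prop :=
  forall x, A x -> exists (U : set V) (F : V -> W),
    [/\ open U, U x, smooth_on U F & forall y, A y -> U y -> f y = F y].

End Smooth.

(* M is meant to be an embedded submanifold of the finite-dimensional space V;
   its tangent bundle is then an embedded submanifold of V * V. *)
Section Retraction.
Context {R : realType} {V : normedModType R}.
Implicit Type M : set V.

Definition tangent_space M (x : V) : set V :=
  [set v | exists (e : R) (c : R -> V),
    [/\ 0 < e, smooth_on (ball (0 : R) e) c,
        forall t, ball (0 : R) e t -> M (c t),
        c 0 = x & is_derive (0 : R) 1 c v]].

Definition tangent_bundle M : set (V * V) :=
  [set xv | M xv.1 /\ tangent_space M xv.1 xv.2].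

(* A retraction is represented by a total function on V * V, whose values
   outside the tangent bundle are irrelevant. The last clause says that the
   restriction of f to the tangent space at x has the identity as (Frechet)
   differential at 0. *)
Definition is_retraction M (f : V * V -> V) : Prop :=
  [/\ forall xv, tangent_bundle M xv -> M (f xv),
      smooth_within (tangent_bundle M) f,
      forall x, M x -> f (x, 0) = x
    & forall x, M x -> forall eps : R, 0 < eps ->
        \forall v \near within (tangent_space M x) (nbhs (0 : V)),
          `|f (x, v) - f (x, 0) - v| <= eps * `|v| ].

End Retraction.

Section Grassmann.
Context {R : realType}.

Definition Gr (n p : nat) : set 'M[R]_n :=
  [set P | [/\ P *m P = P, P^T = P & \rank P = p]].

Definition orthogonal_group (n : nat) : set 'M[R]_n :=
  [set Q | Q^T *m Q = 1%:M].

(* The ambient dimension is n = p + q, so that q stands for n - p. *)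
Variables p q : nat.

Definition P0 : 'M[R]_(p + q) := block_mx 1%:M 0 0 0.

Definition proj_of (Q : 'M[R]_(p + q)) : 'M[R]_(p + q) := Q *m P0 *m Q^T.

Definition tangent_of (Q : 'M[R]_(p + q)) (D : 'M[R]_(q, p)) :
    'M[R]_(p + q) :=
  Q *m block_mx 0 D^T D 0 *m Q^T.

Definition phi (B : 'M[R]_(q, p)) : 'M[R]_(p + q) :=
  col_mx 1%:M B *m invmx (1%:M + B^T *m B) *m row_mx 1%:M B^T.

Definition phiQ (Q : 'M[R]_(p + q)) (B : 'M[R]_(q, p)) : 'M[R]_(p + q) :=
  Q *m phi B *m Q^T.

End Grassmann.

Arguments Gr {R} n p.
Arguments orthogonal_group {R} n.
Arguments proj_of {R p q} Q.
Arguments tangent_of {R p q} Q D.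

(* Main.v *)
(* Eliminating Q from Q phi(D) Q^T gives the rational formula
     R_P(X) = (1 + X) P (1 + X^2)^-1 (1 + X)
   in the ambient coordinates, which is thus independent of Q and smooth where
   1 + X^2 is invertible, in particular at every symmetric X. Differentiating
   P^T = P and P^2 = P along curves shows that a tangent vector X at P is
   symmetric with X = XP + PX, hence off-diagonal in an orthonormal basis
   adapted to P. For such X the formula factors as R_P(X) - P - X = X H(X),
   where H is continuous and H(0) = 0, hence the differential at 0 is the
   identity. *)
Require Import Defs.
From HB Require Import structures.
From mathcomp Require Import all_boot all_order all_algebra.
From mathcomp Require Import all_classical all_reals all_analysis.

Set Implicit Arguments.
Unset Strict Implicit.
Unset Printing Implicit Defensive.

Import Order.TTheory GRing.Theory Num.Theory.
Import numFieldNormedType.Exports.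

Local Open Scope classical_set_scope.
Local Open Scope ring_scope.

(** * Calculus of C^k functions and of matrix-valued smooth maps *)

Section SmoothCalculus.
Context {R : realType} {V : normedModType R}.
Implicit Types (W : normedModType R) (U : set V).

(** Near x both functions have the same increments, so the first-order expansion of [f] is one of
    [g], and uniqueness of the differential identifies ['d f x] with ['d g x]. *)
Lemma near_eq_differentiable W (f g : V -> W) (x : V) :
  {near x, f =1 g} -> differentiable f x -> differentiable g x.
Proof.
move=> fg df.
have gE : g \o shift x = cst (g x) + 'd f x +o_ (0 : V) id.
  apply/eqaddoP => e e0.
  have /eqaddoP/(_ e e0) := diff_locally df.
  have : \forall h \near (0 : V), f (h + x) = g (h + x).
    by move: fg; rewrite (near_shift 0 x)/=; apply: filterS => h; rewrite subr0.
  apply: filterS2 => h; rewrite !fctE/= => ->.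
  by rewrite (nbhs_singleton fg).
have dgE := diff_unique (diff_continuous df) gE.
by apply/diff_locallyP; rewrite dgE; split => //; exact: diff_continuous.
Qed.

(** Openness turns equality on [U] into equality near each of its points, so directional derivatives
    agree on [U] as well and the induction goes on. This allows derivative formulas valid only on
    [U] to be substituted under [Ck_on]. *)
Lemma Ck_on_eq W U k (f g : V -> W) :
  open U -> (forall x, U x -> f x = g x) -> Ck_on k U f -> Ck_on k U g.
Proof.
move=> oU; elim: k f g => [|k IH] f g fg /=.
  move=> fc x Ux; have fgx : {near x, f =1 g}.
    by apply: filterS (open_nbhs_nbhs (conj oU Ux)) => y /fg.
  rewrite /prop_for /continuous_at -(fg _ Ux).
  by apply: cvg_trans (fc x Ux); apply: near_eq_cvg.
have fgn x : U x -> {near x, f =1 g}.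
  by move=> Ux; apply: filterS (open_nbhs_nbhs (conj oU Ux)) => y /fg.
move=> [fd fk]; split=> [x Ux|v].
  exact: near_eq_differentiable (fgn x Ux) (fd x Ux).
by apply: (IH _ _ _ (fk v)) => x /fgn; exact: near_eq_derive.
Qed.

Lemma Ck_onS W U k (f : V -> W) : Ck_on k.+1 U f -> Ck_on k U f.
Proof.
elim: k f => [|k IH] f /= [fd fk].
  by move=> x Ux; exact: differentiable_continuous (fd x Ux).
by split=> // v; apply: IH.
Qed.

Lemma Ck_on_cst W U k (a : W) : Ck_on k U (fun _ : V => a).
Proof.
elim: k a => [|k IH] a /=; first by move=> x _; exact: cvg_cst.
split=> [x _|v]; first exact: differentiable_cst.
suff -> : (fun x : V => 'D_v (fun _ : V => a) x) = (fun=> 0) by exact: IH.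
by apply/funext => x; exact: derive_cst.
Qed.

Lemma Ck_on_linear W U k (f : {linear V -> W}) : continuous f -> Ck_on k U f.
Proof.
move=> fc; case: k => [|k] /=; first by move=> x _; exact: fc.
split=> [x _|v]; first exact: linear_differentiable.
suff -> : (fun x : V => 'D_v f x) = (fun=> f v) by exact: Ck_on_cst.
apply/funext => x; rewrite deriveE; last exact: linear_differentiable.
by rewrite diff_lin.
Qed.

Lemma Ck_onD W U k (f g : V -> W) :
  open U -> Ck_on k U f -> Ck_on k U g -> Ck_on k U (fun x => f x + g x).
Proof.
move=> oU; elim: k f g => [|k IH] f g /=.
  by move=> fc gc x Ux; apply: cvgD; [exact: fc|exact: gc].
move=> [fd fk] [gd gk]; split=> [x Ux|v].
  by apply: differentiableD; [exact: fd|exact: gd].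
apply: Ck_on_eq (IH _ _ (fk v) (gk v)) => // x Ux /=.
by rewrite -deriveD//; apply: diff_derivable; [exact: fd|exact: gd].
Qed.

(** The Leibniz rule multiplies a derivative of one factor by the other factor itself; [Ck_onS]
    lowers the latter to the order of the induction hypothesis. *)
Lemma Ck_onM U k (f g : V -> R) :
  open U -> Ck_on k U f -> Ck_on k U g -> Ck_on k U (fun x => f x * g x).
Proof.
move=> oU; elim: k f g => [|k IH] f g /=.
  by move=> fc gc x Ux; apply: cvgM; [exact: fc|exact: gc].
move=> fS gS; have [fd fk] := fS; have [gd gk] := gS.
split=> [x Ux|v].
  by apply: differentiableM; [exact: fd|exact: gd].
have := Ck_onD oU (IH _ _ (Ck_onS fS) (gk v)) (IH _ _ (Ck_onS gS) (fk v)).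
apply: Ck_on_eq => // x Ux /=.
by rewrite -deriveM//; apply: diff_derivable; [exact: fd|exact: gd].
Qed.

(** The derivative of 1/f is -(1/f)(1/f) ['D_v f], which involves 1/f only at the previous order, so
    the induction closes. *)
Lemma Ck_onV U k (f : V -> R) :
  open U -> (forall x, U x -> f x != 0) ->
  Ck_on k U f -> Ck_on k U (fun x => (f x)^-1).
Proof.
move=> oU f0; elim: k => [|k IH].
  by move=> fc x Ux; apply: cvgV; [exact: f0|exact: fc].
move=> fS; have [fd fk] := fS.
split=> [x Ux|v].
  by apply: differentiableV; [exact: fd|exact: f0].
have iS := IH (Ck_onS fS).
have := Ck_onM oU (@Ck_on_cst R U k (-1))
  (Ck_onM oU (Ck_onM oU iS iS) (fk v)).
apply: Ck_on_eq => // x Ux /=.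
rewrite deriveV ?f0//; last by apply: diff_derivable; exact: fd.
by rewrite mulN1r /GRing.scale/= mulNr expr2 invfM.
Qed.

Lemma Ck_onZl W U k (f : V -> R) (w : W) :
  open U -> Ck_on k U f -> Ck_on k U (fun x => f x *: w).
Proof.
move=> oU; elim: k f => [|k IH] f /=.
  by move=> fc x Ux; apply: cvgZr_tmp; exact: fc.
move=> [fd fk]; split=> [x Ux|v]; first exact/differentiableZl/fd.
apply: Ck_on_eq (IH _ (fk v)) => // x Ux /=.
rewrite [RHS]deriveE; last exact/differentiableZl/fd.
by rewrite diffZl ?deriveE//; exact: fd.
Qed.

Lemma Ck_on_sum W U k (I : Type) (r : seq I) (f : I -> V -> W) :
  open U -> (forall i, Ck_on k U (f i)) ->
  Ck_on k U (fun x => \sum_(i <- r) f i x).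
Proof.
move=> oU fk; elim: r => [|i r IH].
  by under eq_fun do rewrite big_nil; exact: Ck_on_cst.
by under eq_fun do rewrite big_cons; exact: Ck_onD.
Qed.

Lemma Ck_on_prod U k (I : Type) (r : seq I) (f : I -> V -> R) :
  open U -> (forall i, Ck_on k U (f i)) ->
  Ck_on k U (fun x => \prod_(i <- r) f i x).
Proof.
move=> oU fk; elim: r => [|i r IH].
  by under eq_fun do rewrite big_nil; exact: Ck_on_cst.
by under eq_fun do rewrite big_cons; exact: Ck_onM.
Qed.

(** Working entrywise reduces matrix products, determinants and inverses to the scalar rules
    above. *)
Definition coord_smooth_on m n U (M : V -> 'M[R]_(m, n)) : Prop :=
  forall i j, smooth_on U (fun x => M x i j).

Lemma coord_smooth_on_smooth m n U (M : V -> 'M[R]_(m, n)) :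
  open U -> coord_smooth_on U M -> smooth_on U M.
Proof.
move=> oU MS k.
have -> : M = fun x => \sum_i \sum_j M x i j *: delta_mx i j.
  by apply/funext => x; exact: matrix_sum_delta.
apply: Ck_on_sum => // i; apply: Ck_on_sum => // j.
exact: Ck_onZl (MS i j k).
Qed.

Lemma coord_smooth_cst m n U (A : 'M[R]_(m, n)) : coord_smooth_on U (fun=> A).
Proof. by move=> i j k; exact: (@Ck_on_cst R). Qed.

Lemma coord_smoothD m n U (M N : V -> 'M[R]_(m, n)) :
  open U -> coord_smooth_on U M -> coord_smooth_on U N ->
  coord_smooth_on U (fun x => M x + N x).
Proof.
Proof.
move=> oU MS NS i j k.
have : Ck_on k U (fun x => M x i j + N x i j).
  by apply: (@Ck_onD R); [exact: oU|exact: MS|exact: NS].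
by apply: Ck_on_eq => // x _; rewrite mxE.
Qed.

Lemma coord_smoothM m n l U (M : V -> 'M[R]_(m, n)) (N : V -> 'M[R]_(n, l)) :
  open U -> coord_smooth_on U M -> coord_smooth_on U N ->
  coord_smooth_on U (fun x => M x *m N x).
Proof.
move=> oU MS NS i j k.
have : Ck_on k U (fun x => \sum_s M x i s * N x s j).
  apply: (@Ck_on_sum R) => // s.
  by apply: Ck_onM; [exact: oU|exact: MS|exact: NS].
by apply: Ck_on_eq => // x _; rewrite mxE.
Qed.

Lemma smooth_det n U (M : V -> 'M[R]_n) :
  open U -> coord_smooth_on U M -> smooth_on U (fun x => \det (M x)).
Proof.
move=> oU MS k; rewrite /determinant.
apply: (@Ck_on_sum R) => // s; apply: Ck_onM => //; first exact: (@Ck_on_cst R).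
by apply: Ck_on_prod => // i; exact: MS.
Qed.

(** Cramer's rule: each entry of the inverse is a cofactor divided by the determinant, and a
    cofactor is up to sign the determinant of a minor. *)
Lemma coord_smooth_inv n U (M : V -> 'M[R]_n) :
  open U -> coord_smooth_on U M -> (forall x, U x -> M x \in unitmx) ->
  coord_smooth_on U (fun x => invmx (M x)).
Proof.
move=> oU MS Mu i j k.
have : Ck_on k U (fun x => (\det (M x))^-1 * cofactor (M x) j i).
  apply: Ck_onM => //.
    apply: Ck_onV => //; last exact: smooth_det.
    by move=> x /Mu; rewrite unitmxE unitfE.
  rewrite /cofactor; apply: Ck_onM => //; first exact: (@Ck_on_cst R).
  apply: smooth_det => // i' j' k'.
  by apply: Ck_on_eq (MS _ _ k') => // x _; rewrite !mxE.
by apply: Ck_on_eq => // x /Mu Mux; rewrite /invmx Mux !mxE.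
Qed.

Lemma coord_smooth_linear m n U (f : {linear V -> 'M[R]_(m, n)}) :
  continuous f -> coord_smooth_on U f.
Proof.
move=> fc i j k.
have lin_fij : linear (fun x => f x i j : R).
  by move=> a x y; rewrite linearP !mxE.
pose fijM := GRing.isLinear.Build _ _ _ _ _ lin_fij.
pose fij : {linear V -> R} := HB.pack (fun x => f x i j : R) fijM.
have fijc : continuous fij.
  by move=> x;
    exact: (continuous_comp (fc x) (@coord_continuous R m n i j (f x))).
exact: (Ck_on_linear U k fijc).
Qed.

Lemma open_unitmx n (M : V -> 'M[R]_n) :
  coord_smooth_on setT M -> open [set x | M x \in unitmx].
Proof.
move=> MS.
have detc : continuous (fun x => \det (M x)).
  by move=> x; apply: (smooth_det openT MS 0).
rewrite (_ : mkset _ = (fun x => \det (M x)) @^-1` [set y | y != 0]).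
  by apply: open_comp; [move=> x _; exact: detc|exact: open_neq].
by apply/seteqP; split=> x /=; rewrite unitmxE unitfE.
Qed.

End SmoothCalculus.

(** * Gram matrices, orthonormal bases and ranks over the reals *)

Section RealMatrices.
Context {R : realType}.

Lemma mulmx_trmx_ge0 n (u : 'rV[R]_n) : 0 <= (u *m u^T) 0 0.
Proof. by rewrite mxE sumr_ge0// => i _; rewrite mxE -expr2 sqr_ge0. Qed.

Lemma mulmx_trmx_eq0 n (u : 'rV[R]_n) : (u *m u^T) 0 0 = 0 -> u = 0.
Proof.
rewrite mxE => /eqP; rewrite psumr_eq0; last first.
  by move=> i _; rewrite mxE -expr2 sqr_ge0.
move=> /allP u0; apply/rowP => i; rewrite mxE.
by have := u0 i; rewrite mem_index_enum mxE mulf_eq0 orbb => /(_ isT)/eqP.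
Qed.

(** If u (1 + B^T B) = 0, multiplying by u^T gives |u|^2 + |u B^T|^2 = 0, so u = 0. For symmetric X
    this makes 1 + X^2 invertible. *)
Lemma unitmx_add1_gram m n (B : 'M[R]_(m, n)) : 1%:M + B^T *m B \in unitmx.
Proof.
rewrite -row_free_unit; apply/inj_row_free => u u0; apply: mulmx_trmx_eq0.
have : u *m u^T + (u *m B^T) *m (u *m B^T)^T = 0.
  by rewrite trmx_mul trmxK !mulmxA -mulmxDl -(mulmxA u) -{1}(mulmx1 u)
    -mulmxDr u0 mul0mx.
move=> /(congr1 (fun M : 'M[R]_1 => M 0 0)); rewrite mxE [RHS]mxE => /eqP.
by rewrite paddr_eq0 ?mulmx_trmx_ge0// => /andP[/eqP].
Qed.

(** Gram-Schmidt, by induction on the number of rows: the first row is orthogonalized against an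
    orthonormal family obtained from the others. *)
Lemma orthonormal_rows n m (A : 'M[R]_(m, n)) : row_free A ->
  exists2 C : 'M[R]_(m, n), C *m C^T = 1%:M & (C <= A)%MS.
Proof.
elim: m A => [|m IH] A freeA.
  by exists 0; rewrite ?sub0mx//; apply/matrixP => -[].
pose a := usubmx (A : 'M[R]_(1 + m, n)).
pose B := dsubmx (A : 'M[R]_(1 + m, n)).
have AE : A = col_mx a B by rewrite vsubmxK.
have freeB : row_free B.
  apply/inj_row_free => v vB0.
  have : row_mx (0 : 'rV[R]_1) v *m A = 0.
    by rewrite AE mul_row_col mul0mx add0r.
  move/eqP; rewrite mulmx_free_eq0// => /eqP.
  by rewrite -[RHS]row_mx0 => /eq_row_mx[].
have [C C1 CB] := IH B freeB.
have /andP[aA BA] : (a <= A)%MS && (B <= A)%MS by rewrite -col_mx_sub -AE.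
(* The component of [a] orthogonal to the rows of [C]. *)
pose b := a - a *m C^T *m C.
have bC : b *m C^T = 0 by rewrite mulmxBl -!mulmxA C1 mulmx1 subrr.
(* Otherwise [a] would be a combination of the rows of [B], a nontrivial relation among the rows of
   [A]. *)
have bn0 : b != 0.
  apply/eqP => b0; have /submxP[w aE] : (a <= B)%MS.
    by move/subr0_eq : b0 => ->; apply: mulmx_sub.
  have : row_mx (1%:M : 'rV[R]_1) (- w) *m A = 0.
    by rewrite AE mul_row_col mul1mx mulNmx -aE subrr.
  move/eqP; rewrite mulmx_free_eq0// => /eqP.
  rewrite -[RHS]row_mx0 => /eq_row_mx[/(congr1 (fun M : 'M[R]_1 => M 0 0))].
  by rewrite !mxE => /eqP; rewrite oner_eq0.
pose s := (b *m b^T) 0 0.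
have s_gt0 : 0 < s.
  rewrite lt_neqAle mulmx_trmx_ge0 andbT eq_sym; apply: contra_neq bn0.
  exact: mulmx_trmx_eq0.
pose c := (Num.sqrt s)^-1 *: b.
have cc : c *m c^T = 1%:M.
  rewrite linearZ/= -scalemxAl -scalemxAr (mx11_scalar (b *m b^T)) -/s.
  rewrite !scale_scalar_mx mulrA -invfM -expr2 sqr_sqrtr ?(ltW s_gt0)//.
  by rewrite mulVf ?gt_eqF.
have cC : c *m C^T = 0 by rewrite -scalemxAl bC scaler0.
have Cc : C *m c^T = 0 by rewrite -[LHS]trmxK trmx_mul trmxK cC trmx0.
have cC1 : col_mx c C *m (col_mx c C)^T = 1%:M.
  by rewrite tr_col_mx mul_col_row cc cC Cc C1 -scalar_mx_block.
have cCA : (col_mx c C <= A)%MS.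
  rewrite col_mx_sub (submx_trans CB BA) andbT scalemx_sub//.
  by rewrite addmx_sub// eqmx_opp mulmx_sub// (submx_trans CB BA).
by exists (col_mx c C); [exact: cC1|exact: cCA].
Qed.

Lemma orthonormal_basis n m (A : 'M[R]_n) : \rank A = m ->
  exists2 C : 'M[R]_(m, n), C *m C^T = 1%:M & (C <= A)%MS.
Proof.
move=> <-; have [C C1 CA] := orthonormal_rows (row_base_free A).
by exists C => //; rewrite (submx_trans CA)// eq_row_base.
Qed.

(** P (1 - P) = 0 bounds the sum of the ranks by n from above, and P + (1 - P) = 1 bounds it from
    below. *)
Lemma mxrank_idem_compl n (P : 'M[R]_n) : P *m P = P ->
  (\rank P + \rank (1%:M - P)%R)%N = n.
Proof.
move=> PP; apply/eqP; rewrite eqn_leq mulmx0_rank_max; last first.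
  by rewrite mulmxBr mulmx1 PP subrr.
rewrite -[X in (X <= _)%N](mxrank1 R n).
by rewrite -[in X in (X <= _)%N](subrKC P 1%:M) mxrank_add.
Qed.

(** * Orthogonal projectors in adapted bases and the rational retraction formula *)

Section Projectors.
Variables p q : nat.
Implicit Types (P X Q : 'M[R]_(p + q)) (D : 'M[R]_(q, p)).

(** The columns of [Q] are orthonormal bases of the row spaces of P and of 1 - P. These spaces are
    orthogonal because P is symmetric, and P acts on them as 1 and 0, so Q^T P Q is [P0]. *)
Lemma Gr_proj_of P : Gr (p + q) p P ->
  exists2 Q, orthogonal_group (p + q) Q & P = proj_of Q.
Proof.
move=> [PP PT rP].
have rP' : \rank (1%:M - P) = q.
  by apply/eqP; rewrite -(eqn_add2l p) -[X in (X + _)%N]rP mxrank_idem_compl.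
have [C C1 /submxP[U CE]] := orthonormal_basis rP.
have [C' C'1 /submxP[U' C'E]] := orthonormal_basis rP'.
have CP : C *m P = C by rewrite CE -mulmxA PP.
have C'P : C' *m P = 0 by rewrite C'E -mulmxA mulmxBl mul1mx PP subrr mulmx0.
have C'C : C' *m C^T = 0.
  by rewrite -CP trmx_mul PT mulmxA C'P mul0mx.
have CC' : C *m C'^T = 0 by rewrite -[LHS]trmxK trmx_mul trmxK C'C trmx0.
pose Q := row_mx C^T C'^T.
have QT : Q^T = col_mx C C' by rewrite tr_row_mx !trmxK.
have QQ : Q^T *m Q = 1%:M.
  by rewrite QT mul_col_row C1 C'1 C'C CC' -scalar_mx_block.
exists Q => //; rewrite /proj_of.
have -> : P0 p q = Q^T *m P *m Q.
  by rewrite QT mul_col_mx CP C'P mul_col_row C1 CC' !mul0mx.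
have QQ' := mulmx1C QQ.
by rewrite !mulmxA QQ' mul1mx -mulmxA QQ' mulmx1.
Qed.

(** With the next three lemmas, conjugation by Q is an injective unital ring morphism, so identities
    in P and X can be checked blockwise with [P0] in place of P. *)
Lemma orthogonal_conjM Q (A B : 'M[R]_(p + q)) : orthogonal_group (p + q) Q ->
  (Q *m A *m Q^T) *m (Q *m B *m Q^T) = Q *m (A *m B) *m Q^T.
Proof.
move=> QQ; rewrite !mulmxA -(mulmxA _ Q^T Q) (_ : Q^T *m Q = 1%:M)//.
by rewrite mulmx1.
Qed.

Lemma orthogonal_conj_inj Q : orthogonal_group (p + q) Q ->
  injective (fun A : 'M[R]_(p + q) => Q *m A *m Q^T).
Proof.
move=> QQ A B /(congr1 (fun M => Q^T *m M *m Q)).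
have QQ' : Q^T *m Q = 1%:M by [].
by rewrite !mulmxA QQ' !mul1mx -!mulmxA QQ' !mulmx1.
Qed.

Lemma orthogonal_conj1 Q : orthogonal_group (p + q) Q ->
  Q *m 1%:M *m Q^T = 1%:M.
Proof. by move=> QQ; rewrite mulmx1; exact: mulmx1C. Qed.

Lemma orthogonal_conjD Q (A B : 'M[R]_(p + q)) :
  Q *m A *m Q^T + Q *m B *m Q^T = Q *m (A + B) *m Q^T.
Proof. by rewrite mulmxDr mulmxDl. Qed.

Lemma tangent_of_inj Q : orthogonal_group (p + q) Q ->
  injective (tangent_of Q : 'M[R]_(q, p) -> _).
Proof. by move=> QQ D D' /(orthogonal_conj_inj QQ)/eq_block_mx[]. Qed.

(** In the basis given by Q the relation reads Y = Y P0 + P0 Y. Its upper left block says A = A + A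
    and its lower right block is 0, so both diagonal blocks of Y vanish; symmetry relates the other
    two. *)
Lemma tangent_ofP P X Q : orthogonal_group (p + q) Q -> P = proj_of Q ->
  X^T = X -> X = X *m P + P *m X -> exists D, X = tangent_of Q D.
Proof.
move=> QQ PE XT XE.
pose Y := Q^T *m X *m Q.
have QQ' := mulmx1C (QQ : Q^T *m Q = 1%:M).
have YX : X = Q *m Y *m Q^T.
  by rewrite !mulmxA QQ' mul1mx -mulmxA QQ' mulmx1.
have YT : Y^T = Y by rewrite !trmx_mul trmxK XT mulmxA.
clearbody Y.
have YE : Y = Y *m P0 p q + P0 p q *m Y.
  apply: (orthogonal_conj_inj QQ) => /=.
  by rewrite -orthogonal_conjD -!orthogonal_conjM// -!YX -!/(proj_of Q) -PE.
exists (dlsubmx Y); rewrite {1}YX /tangent_of; congr (_ *m _ *m _).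
rewrite -[LHS]submxK.
move: YE; rewrite -{1 2 3}(submxK Y) !mulmx_block add_block_mx.
rewrite !mulmx0 !mul0mx !addr0 !mulmx1 !mul1mx => /eq_block_mx[ul _ _ ->].
congr block_mx; last by rewrite trmx_dlsub YT.
by apply/eqP; rewrite -(inj_eq (addrI (ulsubmx Y))) -ul addr0.
Qed.

(** Total on all pairs: [invmx] returns its argument where 1 + X^2 is singular, which does not occur
    for symmetric X. *)
Definition Gr_retr (PX : 'M[R]_(p + q) * 'M[R]_(p + q)) : 'M[R]_(p + q) :=
  (1%:M + PX.2) *m PX.1 *m invmx (1%:M + PX.2 *m PX.2) *m (1%:M + PX.2).

(** In the basis given by Q, X becomes [N], whose square is block diagonal with blocks D^T D and D
    D^T. The first block column of 1 + N is (1; D) and its first block row is (1, D^T), which are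
    the outer factors of [phi D]. *)
Lemma Gr_retr_phiQ P X Q D : orthogonal_group (p + q) Q ->
  P = proj_of Q -> X = tangent_of Q D -> Gr_retr (P, X) = phiQ Q D.
Proof.
move=> QQ PE XE; rewrite /Gr_retr/=.
set N := block_mx (0 : 'M[R]_p) D^T D 0.
set S := 1%:M + D^T *m D.
have Su : S \in unitmx by exact: unitmx_add1_gram.
have X1 : 1%:M + X = Q *m (1%:M + N) *m Q^T.
  by rewrite -orthogonal_conjD orthogonal_conj1// XE.
have XX : 1%:M + X *m X = Q *m (1%:M + N *m N) *m Q^T.
  by rewrite -orthogonal_conjD orthogonal_conj1// XE orthogonal_conjM.
have NT : N^T = N by rewrite tr_block_mx !trmx0 trmxK.
have NNu : 1%:M + N *m N \in unitmx.
  by rewrite -[X in X *m _]NT; exact: unitmx_add1_gram.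
have XXV : invmx (1%:M + X *m X) = Q *m invmx (1%:M + N *m N) *m Q^T.
  have XXu : 1%:M + X *m X \in unitmx.
    by rewrite XX !unitmx_mul NNu unitmx_tr andbT;
      case/mulmx1_unit : QQ => _ ->.
  apply: (can_inj (mulKmx XXu)).
  by rewrite mulmxV// XX orthogonal_conjM// mulmxV// orthogonal_conj1.
(* [P0] kills the lower block of the inverse, so only [S] has to be inverted explicitly. *)
have P0V : P0 p q *m invmx (1%:M + N *m N) = block_mx (invmx S) 0 0 0.
  apply: (can_inj (mulmxK NNu)); rewrite mulmxKV//.
  rewrite mulmx_block scalar_mx_block add_block_mx mulmx_block.
  by rewrite !mulmx0 !mul0mx !addr0 !add0r mulmx0 mulVmx.
rewrite XXV X1 PE /proj_of orthogonal_conjM// orthogonal_conjM//.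
rewrite orthogonal_conjM// -(mulmxA _ (P0 p q)) P0V /phiQ.
congr (_ *m _ *m _).
rewrite scalar_mx_block add_block_mx !addr0 !add0r !mulmx_block.
rewrite !(mulmx0, mulmx1, mul1mx, addr0) !mul0mx !addr0 /phi.
by rewrite mul_col_mx mul1mx mul_col_row !mulmx1.
Qed.

(** With V = (1; D) and V^T V = S, [phi D] is V S^-1 V^T, the orthogonal projector onto the column
    space of V. *)
Lemma phiQ_Gr Q D : orthogonal_group (p + q) Q -> Gr (p + q) p (phiQ Q D).
Proof.
move=> QQ; set S := 1%:M + D^T *m D.
have Su : S \in unitmx by exact: unitmx_add1_gram.
have VV : row_mx 1%:M D^T *m col_mx 1%:M D = S.
  by rewrite mul_row_col mulmx1.
have VT : (col_mx 1%:M D)^T = row_mx 1%:M D^T by rewrite tr_col_mx trmx1.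
have ST : S^T = S by rewrite linearD/= trmx1 trmx_mul trmxK.
split.
- rewrite /phiQ orthogonal_conjM//; congr (_ *m _ *m _).
  rewrite /phi -!mulmxA; congr (_ *m _).
  rewrite (mulmxA (row_mx _ _)) VV !mulmxA.
  by rewrite -(mulmxA (invmx S)) mulmxV ?mulmx1.
- rewrite /phiQ !trmx_mul trmxK mulmxA -/S; congr (_ *m _ *m _).
  by rewrite /phi VT trmx_inv -/S ST -VT trmxK mulmxA.
- have [QTu Qu] := mulmx1_unit QQ.
  rewrite /phiQ mxrankMfree ?row_free_unit//.
  rewrite -mxrank_tr trmx_mul mxrankMfree ?row_free_unit// mxrank_tr.
  (* The rank is at most p since [phi D] factors through V, which has p columns. It is at least p
     since the upper left block of [phi D] is the invertible p by p matrix [invmx S]. *)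
  apply/eqP; rewrite eqn_leq; apply/andP; split.
    by rewrite /phi -mulmxA (leq_trans (mxrankM_maxl _ _))// rank_leq_col.
  have {1}<- : \rank (invmx S) = p.
    by apply/eqP; rewrite -[_ == _]/(row_free _) row_free_unit unitmx_inv.
  have -> : invmx S = row_mx 1%:M 0 *m (phi D *m col_mx 1%:M 0).
    rewrite /phi -/S !mulmxA mul_row_col mul1mx mul0mx addr0 mul1mx.
    by rewrite -mulmxA mul_row_col mulmx0 !mulmx1 addr0 mulmx1.
  by rewrite (leq_trans (mxrankM_maxr _ _))// mxrankM_maxl.
Qed.

End Projectors.
End RealMatrices.

Arguments Gr_retr {R p q} PX.

(** * Norm estimates and the product rule for matrices *)

Section MatrixCalculus.
Context {R : realType}.

Lemma ler_coord_norm m n (A : 'M[R]_(m, n)) i j : `|A i j| <= `|A|.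
Proof.
rewrite [leRHS]/Num.Def.normr/= mx_normrE.
exact: (le_bigmax _ (fun ij => `|A ij.1 ij.2|) (i, j)).
Qed.

(** The norm is the largest absolute value of an entry, and an entry of the product is a sum of n
    terms; hence the factor n. *)
Lemma ler_norm_mulmx m n l (A : 'M[R]_(m, n)) (B : 'M[R]_(n, l)) :
  `|A *m B| <= n%:R * `|A| * `|B|.
Proof.
rewrite [leLHS]/Num.Def.normr/= mx_normrE.
apply: bigmax_le => [|[i j] _ /=]; first by rewrite !mulr_ge0.
rewrite mxE (le_trans (ler_norm_sum _ _ _))//.
rewrite -mulrA mulr_natl -[X in _ *+ X]card_ord -sumr_const.
by apply: ler_sum => k _; rewrite normrM ler_pM// ler_coord_norm.
Qed.

Lemma is_derive_coord m n (c : R -> 'M[R]_(m, n)) (t : R)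
    (X : 'M[R]_(m, n)) i j :
  is_derive t 1 c X -> is_derive t 1 (fun s => c s i j) (X i j).
Proof.
move=> [dc cX]; apply: DeriveDef; first exact: (derivable_mxP _ _ _).1.
by move: cX; rewrite derive_mx// => <-; rewrite mxE.
Qed.

Lemma is_derive_mulmx m n l (c : R -> 'M[R]_(m, n)) (d : R -> 'M[R]_(n, l))
    (t : R) (X : 'M[R]_(m, n)) (Y : 'M[R]_(n, l)) i j :
  is_derive t 1 c X -> is_derive t 1 d Y ->
  is_derive t 1 (fun s => (c s *m d s) i j) ((X *m d t + c t *m Y) i j).
Proof.
move=> cX dY.
have -> : (fun s => (c s *m d s) i j) =
    \sum_(k < n) ((fun s => c s i k) * (fun s => d s k j)).
  by apply/funext => s; rewrite mxE fct_sumE.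
have -> : (X *m d t + c t *m Y) i j =
    \sum_(k < n) (c t i k *: Y k j + d t k j *: X i k).
  rewrite !mxE -big_split/=; apply: eq_bigr => k _.
  by rewrite addrC /GRing.scale/= (mulrC (X i k)).
apply: is_derive_sum => k.
by apply: is_deriveM; exact: is_derive_coord.
Qed.

End MatrixCalculus.

(** * Tangent vectors of the Grassmannian and the retraction axioms *)

Section GrassmannRetraction.
Context {R : realType}.

Lemma tangent_space_Gr n r (P X : 'M[R]_n) : tangent_space (Gr n r) P X ->
  X^T = X /\ X = X *m P + P *m X.
Proof.
move=> [e [c [e0 _ cGr c0 cX]]].
(* The curve is known to stay in [Gr] only on this ball, so the defining equations are
   differentiated as equalities near 0. *)
have near_ball : \forall t \near (0 : R), ball (0 : R) e t.
  by near=> t; near: t; exact: nbhsx_ballx.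
split; apply/matrixP => i j.
  rewrite mxE; have [_ <-] := is_derive_coord j i cX.
  have [_ <-] := is_derive_coord i j cX.
  apply: near_eq_derive; apply: filterS near_ball => t /cGr[_ cT _].
  by rewrite -[in LHS]cT mxE.
have [_ <-] := is_derive_coord i j cX.
rewrite -c0; have [_ <-] := is_derive_mulmx i j cX cX.
apply: near_eq_derive; apply: filterS near_ball => t /cGr[cc _ _].
by rewrite cc.
Unshelve. all: by end_near. Qed.

Variables p q : nat.
Local Notation M := 'M[R]_(p + q).

Lemma smooth_Gr_retr : smooth_within (tangent_bundle (Gr (p + q) p))
  (Gr_retr : M * M -> M).
Proof.
pose D (PX : M * M) : M := 1%:M + PX.2 *m PX.2.
have fstS U : coord_smooth_on U (fst : M * M -> M).
  exact: (@coord_smooth_linear _ _ _ _ _ fst (fun x => cvg_fst)).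
have sndS U : coord_smooth_on U (snd : M * M -> M).
  exact: (@coord_smooth_linear _ _ _ _ _ snd (fun x => cvg_snd)).
have DS U : open U -> coord_smooth_on U D.
  move=> oU; apply: coord_smoothD => //; first exact: coord_smooth_cst.
  exact: coord_smoothM.
move=> [P X] [/= _ /tangent_space_Gr[XT _]].
have oU := open_unitmx (DS _ openT).
(* One open set and one extension, the formula itself, serve at every point of the tangent
   bundle. *)
exists [set PX | D PX \in unitmx], Gr_retr; split=> //.
  by rewrite /= /D/= -{1}XT unitmx_add1_gram.
have S1 : coord_smooth_on [set PX | D PX \in unitmx] (fun PX => 1%:M + PX.2).
  by apply: coord_smoothD => //; exact: coord_smooth_cst.
apply: coord_smooth_on_smooth => //.
do 2?[apply: coord_smoothM => //].
  exact: coord_smoothM.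
by apply: coord_smooth_inv => //; exact: DS.
Qed.

(** The inverse Z is replaced once by 1 - v^2 Z. The term 1 yields (1 + v) P (1 + v) = P + v + v P
    v; in the other term v^2 commutes with P and moves to the left, where a factor v splits off. *)
Lemma Gr_retr_expansion (P v : M) : P *m P = P -> v^T = v ->
  v = v *m P + P *m v ->
  Gr_retr (P, v) - P - v =
  v *m (P *m v - (v + v *m v) *m P *m invmx (1%:M + v *m v) *m (1%:M + v)).
Proof.
move=> PP vT vE; rewrite /Gr_retr/=; set Z := invmx _.
have Zu : 1%:M + v *m v \in unitmx by rewrite -{1}vT unitmx_add1_gram.
have ZE : Z = 1%:M - v *m v *m Z.
  by rewrite -(mulmxV Zu) mulmxDl mul1mx addrK.
have vP : v *m P = v - P *m v by rewrite {2}vE addrK.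
have Pv : P *m v = v - v *m P by rewrite vP subKr.
(* P v = v (1 - P) and v P = (1 - P) v, so passing two factors v turns P into 1 - P and back. *)
have Pvv : P *m (v *m v) = v *m v *m P.
  by rewrite mulmxA Pv mulmxBl -[RHS]mulmxA [in RHS]vP mulmxBr mulmxA.
rewrite {1}ZE mulmxBr mulmx1 mulmxBl.
have -> : (1%:M + v) *m P *m (1%:M + v) = P + v + v *m P *m v.
  rewrite mulmxDr mulmx1 !mulmxDl !mul1mx -!addrA; congr (_ + _).
  by rewrite addrA -vE.
have -> : (1%:M + v) *m P *m (v *m v *m Z) = v *m ((v + v *m v) *m P *m Z).
  rewrite mulmxA -(mulmxA _ P) Pvv !mulmxA; congr (_ *m _ *m _).
  by rewrite mulmxDl mul1mx mulmxDr mulmxDl !mulmxA.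
rewrite -[LHS]addrA -opprD -[X in X - _]addrA [LHS]addrC addKr.
by rewrite mulmxBr !mulmxA.
Qed.

Lemma is_retraction_Gr_retr :
  is_retraction (Gr (p + q) p) (Gr_retr : M * M -> M).
Proof.
have retr0 P : Gr_retr (P, 0 : M) = P.
  by rewrite /Gr_retr/= mul0mx addr0 invmx1 mul1mx !mulmx1.
split.
- move=> [P X] [/= PGr /tangent_space_Gr[XT XE]].
  have [Q QQ PE] := Gr_proj_of PGr.
  have [D XD] := tangent_ofP QQ PE XT XE.
  by rewrite (Gr_retr_phiQ QQ PE XD); exact: phiQ_Gr.
- exact: smooth_Gr_retr.
- by move=> P _; exact: retr0.
move=> P PGr eps eps0.
have [PP _ _] := PGr.
pose D (v : M) : M := 1%:M + v *m v.
(* The cofactor of v in [Gr_retr_expansion]; the differential condition reduces to its tending to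
   0. *)
pose H (v : M) : M :=
  P *m v - (v + v *m v) *m P *m invmx (D v) *m (1%:M + v).
have idS U : coord_smooth_on U (idfun : M -> M).
  exact: (@coord_smooth_linear _ _ _ _ _ idfun (fun x => cvg_id)).
have sqS U : open U -> coord_smooth_on U (fun v : M => v *m v).
  by move=> oU; apply: coord_smoothM => //; exact: idS.
have DS U : open U -> coord_smooth_on U D.
  move=> oU.
  by apply: coord_smoothD => //; [exact: coord_smooth_cst|exact: sqS].
set U := [set v | D v \in unitmx].
have oU : open U := open_unitmx (DS _ openT).
have HS : coord_smooth_on U H.
  (* The minus sign is absorbed into the constant P, leaving only sums, products and an inverse. *)
  have -> : H = fun v =>
      P *m v + (v + v *m v) *m (- P) *m invmx (D v) *m (1%:M + v).
    by apply/funext => v; rewrite mulmxN !mulNmx.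
  apply: coord_smoothD => //.
    by apply: coord_smoothM => //; exact: coord_smooth_cst.
  apply: coord_smoothM => //; last first.
    by apply: coord_smoothD => //; exact: coord_smooth_cst.
  apply: coord_smoothM => //; last by apply: coord_smooth_inv => //; exact: DS.
  apply: coord_smoothM => //; last exact: coord_smooth_cst.
  by apply: coord_smoothD => //; exact: sqS.
have U0 : U 0 by rewrite /U/= /D mul0mx addr0 unitmx1.
have H0 : H 0 = 0 by rewrite /H mulmx0 mul0mx addr0 !mul0mx subrr.
have Hc : H v @[v --> (0 : M)] --> (0 : M).
  have := coord_smooth_on_smooth oU HS 0%N _ U0.
  by rewrite /prop_for /continuous_at H0.
(* The factor p + q comes from [ler_norm_mulmx], and the added 1 makes [c] visibly positive. Then |H
   v| <= eps / c gives |v H(v)| <= eps |v|. *)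
set c : R := (p + q)%:R + 1.
have c0 : 0 < c by rewrite ltr_wpDl.
have /cvgr0_norm_le/(_ (eps / c)) := Hc.
rewrite divr_gt0// => /(_ isT) Hle.
apply: filterS Hle => v Hv /tangent_space_Gr[vT vE].
rewrite retr0 Gr_retr_expansion// -/(D v) -/(H v).
rewrite (le_trans (ler_norm_mulmx _ _))//.
rewrite mulrAC ler_wpM2r//.
rewrite (le_trans (ler_wpM2l _ Hv))//.
by rewrite mulrCA ler_piMr ?(ltW eps0)// ler_pdivrMr// mul1r lerDl.
Qed.
End GrassmannRetraction.

Theorem theorem1 (R : realType) (p q : nat) (p_gt0 : (0 < p)%N)
    (q_gt0 : (0 < q)%N) :
  (forall P X : 'M[R]_(p + q), tangent_bundle (Gr (p + q) p) (P, X) ->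
     (exists2 Q : 'M[R]_(p + q), orthogonal_group (p + q) Q & P = proj_of Q) /\
     (forall Q : 'M[R]_(p + q), orthogonal_group (p + q) Q -> P = proj_of Q ->
        exists! D : 'M[R]_(q, p), X = tangent_of Q D)) /\
  exists Retr : 'M[R]_(p + q) * 'M[R]_(p + q) -> 'M[R]_(p + q),
    (forall (P X Q : 'M[R]_(p + q)) (D : 'M[R]_(q, p)),
       orthogonal_group (p + q) Q -> P = proj_of Q -> X = tangent_of Q D ->
       Retr (P, X) = phiQ Q D) /\
    is_retraction (Gr (p + q) p) Retr.
Proof.
split=> [P X [/= PGr /tangent_space_Gr[XT XE]]|].
  split=> [|Q QQ PE]; first exact: Gr_proj_of.
  have [D XD] := tangent_ofP QQ PE XT XE.
  by exists D; split=> // D'; rewrite XD => /(tangent_of_inj QQ).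
(* The formula does not mention Q, so its agreement with [phiQ Q D] for every admissible Q and D is
   exactly independence of the choice. *)
exists Gr_retr; split; last exact: is_retraction_Gr_retr.
by move=> P X Q D; exact: Gr_retr_phiQ.
Qed.
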